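(* For all positive integers $q$ and $n$, the following four infinite product identities hold: \[ \prod_{k = 1}^\infty \frac{L_{(2n - 1)(2k + 2q - 1)} + L_{(2n - 1)(2q - 1)} }{L_{(2n - 1)(2k + 2q - 1)} - L_{(2n - 1)(2q - 1)} } = \sqrt 5 \prod_{k = 1}^q \frac{F_{(2k - 1)(2n - 1)} }{L_{(2k - 1)(2n - 1)} } \prod_{k = 1}^{q - 1} \frac{L_{2k(2n - 1)} }{F_{2k(2n - 1)} }, \] \[ \prod_{k = 1}^\infty \frac{F_{2n(2k + 2q - 1)} + F_{2n(2q - 1)} }{F_{2n(2k + 2q - 1)} - F_{2n(2q - 1)} } = \frac{1}{(\sqrt 5 )^{2q - 1} }\prod_{k = 1}^{2q - 1} \frac{L_{2nk} }{F_{2nk} }, \] \[ \prod_{k = 1}^\infty \frac{F_{4n(k + q)} + F_{4nq} }{F_{4n(k + q)} - F_{4nq} } = \frac{1}{5^q }\prod_{k = 1}^{2q} \frac{L_{2nk} }{F_{2nk} }, \] \[ \prod_{k = 1}^\infty \frac{F_{(2n - 1)(2k + 2q)} + F_{2q(2n - 1)} }{F_{(2n - 1)(2k + 2q)} - F_{2q(2n - 1)} } = \prod_{k = 1}^q \frac{F_{(2n - 1)(2k - 1)} L_{(2n - 1)2k} }{L_{(2n - 1)(2k - 1)} F_{(2n - 1)2k} }. \]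
   Context: The Fibonacci numbers $F_j$ and Lucas numbers $L_j$ are defined for integers $j\ge 0$ by $F_0=0$, $F_1=1$, $F_j=F_{j-1}+F_{j-2}$ and $L_0=2$, $L_1=1$, $L_j=L_{j-1}+L_{j-2}$. An empty product $\prod_{k=1}^0$ equals $1$. *)

(* Defs.v *)
From mathcomp Require Export all_boot all_order all_algebra.
From mathcomp Require Export boolp classical_sets reals topology normedtype sequences.
Export Order.TTheory GRing.Theory Num.Theory.
Export numFieldNormedType.Exports.
#[export] Set Implicit Arguments.
#[export] Unset Strict Implicit.
#[export] Unset Printing Implicit Defensive.

Fixpoint fib (j : nat) : nat :=
  match j with
  | 0 => 0
  | 1 => 1
  | (i.+1 as j').+1 => fib j' + fib i
  end.

Fixpoint lucas (j : nat) : nat :=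
  match j with
  | 0 => 2
  | 1 => 1
  | (i.+1 as j').+1 => lucas j' + lucas i
  end.

Local Open Scope ring_scope.
Local Open Scope classical_set_scope.

(* The factors are indexed from 1; u 0 is ignored. *)
Definition infinite_prod_eq (R : realType) (u : nat -> R) (l : R) : Prop :=
  \prod_(1 <= k < N.+1) u k @[N --> \oo] --> l.

(* Main.v *)
(* Put [t j = sqrt 5 * F_j / L_j] ([fib_lucas_ratio]) and let [w j]
   ([alt_ratio]) be [t j] for even [j] and [1 / t j] for odd [j].  With [m] the
   common factor of the indices and [p] equal to [2q - 1] or [2q], the Binet
   formulas factor the numerator and the denominator of each term and turn all
   four products into [\prod_k w (m (k + p)) / w (m k)].  This telescopes to
   [\prod_(j <= p) w (m (N + j)) / w (m j)], and [w] tends to [1]. *)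
Require Import Defs.
From mathcomp Require Import zify ring lra.
Local Open Scope ring_scope.
Local Open Scope classical_set_scope.

(** * Two-step induction, positivity and growth *)

Lemma nat_ind2 (P : nat -> Prop) :
  P 0%N -> P 1%N -> (forall j, P j -> P j.+1 -> P j.+2) -> forall j, P j.
Proof.
move=> P0 P1 PS j; suff [] : P j /\ P j.+1 by [].
by elim: j => // j [Pj PSj]; split=> //; exact: PS.
Qed.

Lemma fibSS j : fib j.+2 = (fib j.+1 + fib j)%N. Proof. by []. Qed.

Lemma lucasSS j : lucas j.+2 = (lucas j.+1 + lucas j)%N. Proof. by []. Qed.

Lemma fib_gt0 j : (0 < j)%N -> (0 < fib j)%N.
Proof. by elim/nat_ind2: j => // j _ IH _; rewrite fibSS ltn_addr ?IH. Qed.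

Lemma lucas_gt0 j : (0 < lucas j)%N.
Proof. by elim/nat_ind2: j => // j _ IH; rewrite lucasSS ltn_addr. Qed.

(** A crude linear bound suffices: it only serves to make [1 / L_j ^ 2] tend to 0. *)
Lemma leq_lucas j : (j <= lucas j)%N.
Proof.
elim/nat_ind2: j => // j _ IH; rewrite lucasSS; have := lucas_gt0 j; lia.
Qed.

(** * Telescoping and limits of products with a fixed number of factors *)

Lemma telescope_prod_shift (F : fieldType) (a : nat -> F) (p N : nat) :
  (forall k, (0 < k)%N -> a k != 0) ->
  \prod_(1 <= k < N.+1) (a (k + p)%N / a k)
  = (\prod_(1 <= j < p.+1) a (j + N)%N) * (\prod_(1 <= j < p.+1) (a j)^-1).
Proof.
move=> a_neq0; elim: p => [|p IH].
  rewrite !big_nil mul1r big_nat big1 // => k /andP[k_gt0 _].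
  by rewrite addn0 divff ?a_neq0.
(* Raising the shift from [p] to [p.+1] multiplies the product by [a (p.+1 + N) / a p.+1]; this is
   an ordinary telescoping, by induction on [N]. *)
rewrite !(big_nat_recr p.+1) //= mulrACA -IH {IH}.
elim: N => [|N IH]; first by rewrite !big_nil mul1r addn0 divff ?a_neq0.
rewrite !(big_nat_recr N.+1) //= IH.
rewrite (_ : (N.+1 + p = p.+1 + N)%N); last by lia.
rewrite (_ : (N.+1 + p.+1 = p.+1 + N.+1)%N); last by lia.
by field; rewrite !a_neq0.
Qed.

Lemma cvg_prod_cst1 (R : realType) (a : nat -> nat -> R) (p : nat) :
  (forall j, a j @ \oo --> (1 : R)) ->
  \prod_(1 <= j < p.+1) a j N @[N --> \oo] --> (1 : R).
Proof.
move=> a_cvg; elim: p => [|p IH].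
  under eq_cvg do rewrite big_nil; exact: cvg_cst.
under eq_cvg do rewrite big_nat_recr //=.
have := cvgM IH (a_cvg p.+1); rewrite mulr1; exact.
Qed.

(** * The golden ratio and the Binet formulas *)

Section binet.
Variable R : realType.
Local Notation s5 := (Num.sqrt (5%:R : R)).

Definition golden : R := (1 + s5) / 2.
Definition golden_conj : R := (1 - s5) / 2.

Local Notation phi := golden.
Local Notation psi := golden_conj.

Lemma sqrt5_gt0 : 0 < s5. Proof. by rewrite sqrtr_gt0 ltr0n. Qed.

Lemma sqr_sqrt5 : s5 * s5 = 5%:R.
Proof. by rewrite -expr2 sqr_sqrtr // ler0n. Qed.

Lemma golden_sqr : phi * phi = phi + 1.
Proof. by have := sqr_sqrt5; rewrite /golden; move: s5 => s h; lra. Qed.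

Lemma golden_conj_sqr : psi * psi = psi + 1.
Proof. by have := sqr_sqrt5; rewrite /golden_conj; move: s5 => s h; lra. Qed.

Lemma goldenXSS j : phi ^+ j.+2 = phi ^+ j.+1 + phi ^+ j.
Proof. by rewrite !(exprS phi) mulrA golden_sqr mulrDl mul1r. Qed.

Lemma golden_conjXSS j : psi ^+ j.+2 = psi ^+ j.+1 + psi ^+ j.
Proof. by rewrite !(exprS psi) mulrA golden_conj_sqr mulrDl mul1r. Qed.

Lemma goldenM_conj : phi * psi = -1.
Proof.
by have := sqr_sqrt5; rewrite /golden /golden_conj; move: s5 => s h; lra.
Qed.

Lemma binet_fib j : s5 * (fib j)%:R = phi ^+ j - psi ^+ j.
Proof.
elim/nat_ind2: j => [||j IH0 IH1].
- by rewrite mulr0 !expr0 subrr.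
- by rewrite !expr1 /golden /golden_conj /= mulr1n; lra.
rewrite fibSS natrD mulrDr IH0 IH1 goldenXSS golden_conjXSS; ring.
Qed.

Lemma binet_lucas j : (lucas j)%:R = phi ^+ j + psi ^+ j.
Proof.
elim/nat_ind2: j => [||j IH0 IH1].
- by rewrite !expr0.
- by rewrite !expr1 /golden /golden_conj /= mulr1n; lra.
rewrite lucasSS natrD IH0 IH1 goldenXSS golden_conjXSS; ring.
Qed.

Lemma goldenM_conjX j : phi ^+ j * psi ^+ j = (-1) ^+ j.
Proof. by rewrite -exprMn goldenM_conj. Qed.

(** * Factorizations of sums and differences at the indices [2v + w] and [w] *)

Lemma fib_addl v w :
  (fib (v + v + w))%:R + (-1) ^+ v * (fib w)%:R
  = (lucas v)%:R * (fib (v + w))%:R :> R.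
Proof.
(* After scaling by [sqrt 5], the product on the right expands by Binet; its cross terms contain
   [(phi * psi) ^ v = (-1) ^ v]. *)
apply: (mulfI (lt0r_neq0 sqrt5_gt0)); rewrite mulrDr mulrCA [RHS]mulrCA.
rewrite !binet_fib binet_lucas -goldenM_conjX !exprD; ring.
Qed.

Lemma fib_subl v w :
  (fib (v + v + w))%:R - (-1) ^+ v * (fib w)%:R
  = (fib v)%:R * (lucas (v + w))%:R :> R.
Proof.
apply: (mulfI (lt0r_neq0 sqrt5_gt0)); rewrite mulrBr mulrCA [RHS]mulrA.
rewrite !binet_fib binet_lucas -goldenM_conjX !exprD; ring.
Qed.

Lemma lucas_addl v w :
  (lucas (v + v + w))%:R + (-1) ^+ v * (lucas w)%:R
  = (lucas v)%:R * (lucas (v + w))%:R :> R.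
Proof. rewrite !binet_lucas -goldenM_conjX !exprD; ring. Qed.

Lemma lucas_subl v w :
  (lucas (v + v + w))%:R - (-1) ^+ v * (lucas w)%:R
  = 5%:R * (fib v)%:R * (fib (v + w))%:R :> R.
Proof.
have -> : 5%:R * (fib v)%:R * (fib (v + w))%:R
  = (s5 * (fib v)%:R) * (s5 * (fib (v + w))%:R).
  by rewrite mulrACA sqr_sqrt5 mulrA.
rewrite !binet_fib !binet_lucas -goldenM_conjX !exprD; ring.
Qed.

(** This is [(a + b)^2 - (a - b)^2 = 4ab] at [a = phi ^ j], [b = psi ^ j]; it controls the distance
    of [fib_lucas_ratio] from 1. *)
Lemma lucas_sqr_fib_sqr j :
  (lucas j)%:R ^+ 2 - (s5 * (fib j)%:R) ^+ 2 = 4%:R * (-1) ^+ j :> R.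
Proof. rewrite binet_fib binet_lucas -goldenM_conjX; ring. Qed.

(** * The ratios, and the terms of the products written in them *)

Definition fib_lucas_ratio (j : nat) : R := s5 * (fib j)%:R / (lucas j)%:R.

(** The inversion at odd indices absorbs the sign [(-1) ^ v] of the factorizations, which exchanges
    sum and difference when [v] is odd. *)
Definition alt_ratio (j : nat) : R :=
  if odd j then (fib_lucas_ratio j)^-1 else fib_lucas_ratio j.

Lemma lucasR_gt0 j : 0 < (lucas j)%:R :> R.
Proof. by rewrite ltr0n lucas_gt0. Qed.

Lemma fibR_neq0 j : (0 < j)%N -> (fib j)%:R != 0 :> R.
Proof. by move=> j_gt0; rewrite pnatr_eq0 -lt0n fib_gt0. Qed.

Lemma lucasR_neq0 j : (lucas j)%:R != 0 :> R.
Proof. exact/lt0r_neq0/lucasR_gt0. Qed.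

Lemma sqrt5_neq0 : s5 != 0. Proof. exact/lt0r_neq0/sqrt5_gt0. Qed.

Lemma alt_ratio_neq0 j : (0 < j)%N -> alt_ratio j != 0.
Proof.
move=> j_gt0; rewrite /alt_ratio /fib_lucas_ratio.
by case: ifP => _; rewrite ?invr_eq0 !mulf_neq0 ?invr_eq0 ?sqrt5_neq0
  ?fibR_neq0 ?lucasR_neq0.
Qed.

(** For even [w] the indices [v] and [v + w] have the same parity, so both ratios are inverted or
    neither is, giving a quotient of ratios. *)
Lemma fib_factor v w : (0 < v)%N -> ~~ odd w ->
  ((fib (v + v + w))%:R + (fib w)%:R) / ((fib (v + v + w))%:R - (fib w)%:R)
  = alt_ratio (v + w) / alt_ratio v.
Proof.
move=> v_gt0 /negPf even_w; have vw_gt0 : (0 < v + w)%N by rewrite ltn_addr.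
have := fib_addl v w; have := fib_subl v w.
rewrite /alt_ratio /fib_lucas_ratio oddD even_w addbF -signr_odd.
case: (odd v); rewrite ?expr1 ?expr0 ?mulN1r ?mul1r ?opprK /= => -> ->;
  by field; rewrite sqrt5_neq0 !lucasR_neq0 !fibR_neq0.
Qed.

(** For odd [w] exactly one of [v] and [v + w] is odd, so the quotient is a product of two ratios or
    its inverse, as the Lucas factorizations require. *)
Lemma lucas_factor v w : (0 < v)%N -> odd w ->
  ((lucas (v + v + w))%:R + (lucas w)%:R)
  / ((lucas (v + v + w))%:R - (lucas w)%:R)
  = alt_ratio (v + w) / alt_ratio v.
Proof.
move=> v_gt0 odd_w; have vw_gt0 : (0 < v + w)%N by rewrite ltn_addr.
have := lucas_addl v w; have := lucas_subl v w.
(* The 5 of [lucas_subl] splits into one [sqrt 5] for each of the two ratios. *)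
rewrite -sqr_sqrt5 /alt_ratio /fib_lucas_ratio oddD odd_w addbT -signr_odd.
case: (odd v); rewrite ?expr1 ?expr0 ?mulN1r ?mul1r ?opprK /= => -> ->;
  by field; rewrite sqrt5_neq0 !lucasR_neq0 !fibR_neq0.
Qed.

(** * Convergence of the ratios and of the infinite products *)

Lemma fib_lucas_ratio_dist j :
  (0 < j)%N -> `|1 - fib_lucas_ratio j| <= 4%:R * j%:R^-1.
Proof.
move=> j_gt0; set t := fib_lucas_ratio j.
have t_ge0 : 0 <= t.
  by rewrite divr_ge0 ?mulr_ge0 ?ler0n // ltW // sqrt5_gt0.
have t2 : (1 - t) * (1 + t) = 4%:R * (-1) ^+ j / (lucas j)%:R ^+ 2.
  rewrite -lucas_sqr_fib_sqr /t /fib_lucas_ratio.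
  by field; rewrite lucasR_neq0.
have L_ge1 : 1 <= (lucas j)%:R :> R by rewrite ler1n lucas_gt0.
(* Since [1 + t >= 1], the factor [1 + t] only enlarges the bound; then [L_j ^ 2 >= L_j >= j]. *)
apply: (@le_trans _ _ (`|(1 - t) * (1 + t)|)).
  by rewrite normrM ler_peMr // ger0_norm ?addr_ge0 // lerDl.
rewrite t2 !normrM normrX normrN1 expr1n mulr1 (ger0_norm (ler0n _ _)).
rewrite ler_wpM2l ?ler0n // ger0_norm ?invr_ge0 ?exprn_ge0 ?ler0n //.
rewrite lef_pV2 ?posrE ?exprn_gt0 ?lucasR_gt0 ?ltr0n //.
rewrite expr2 (@le_trans _ _ (lucas j)%:R) ?ler_nat ?leq_lucas //.
by rewrite ler_peMr.
Qed.

Lemma cvg_fib_lucas_ratio : fib_lucas_ratio @ \oo --> (1 : R).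
Proof.
apply/cvgrPdist_le => e e_gt0; near=> j.
have j_gt0 : (0 < j)%N by near: j; exists 1%N.
apply: le_trans (fib_lucas_ratio_dist j_gt0) _.
rewrite ler_pdivrMr ?ltr0n // -ler_pdivrMl //.
by near: j; exact: nbhs_infty_ger.
Unshelve. all: by end_near. Qed.

Lemma cvg_alt_ratio : alt_ratio @ \oo --> (1 : R).
Proof.
have cv := cvg_fib_lucas_ratio.
have cvV : (fun j => (fib_lucas_ratio j)^-1) @ \oo --> (1 : R).
  have := cvgV (oner_neq0 R) cv; rewrite invr1; exact.
apply/cvgrPdist_lt => e e_gt0; near=> j.
(* Both [t] and [1 / t] are eventually within [e] of 1, whatever the parity of [j]. *)
rewrite /alt_ratio; case: ifP => _; near: j.
  by move/cvgrPdist_lt: cvV; apply.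
by move/cvgrPdist_lt: cv; apply.
Unshelve. all: by end_near. Qed.

Lemma infinite_prod_alt_ratio (m p : nat) (u : nat -> R) : (0 < m)%N ->
  (forall k, (0 < k)%N ->
     u k = alt_ratio (m * k + m * p) / alt_ratio (m * k)) ->
  infinite_prod_eq u (\prod_(1 <= j < p.+1) (alt_ratio (m * j))^-1).
Proof.
move=> m_gt0 uE; rewrite /infinite_prod_eq.
have a_neq0 k : (0 < k)%N -> alt_ratio (m * k) != 0.
  by move=> k_gt0; rewrite alt_ratio_neq0 // muln_gt0 m_gt0.
under eq_cvg => N.
  rewrite (eq_big_nat _ _ (F2 := fun k =>
    alt_ratio (m * (k + p)) / alt_ratio (m * k))); last first.
    by move=> k /andP[k_gt0 _]; rewrite mulnDr uE.
  rewrite (@telescope_prod_shift _ (fun k => alt_ratio (m * k))) //.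
  over.
(* [c] does not depend on [N]; the remaining [p] factors all tend to 1. *)
set c := \prod_(1 <= j < p.+1) (alt_ratio (m * j))^-1.
suff cv1 : \prod_(1 <= j < p.+1) alt_ratio (m * (j + N)) @[N --> \oo]
    --> (1 : R).
  have := cvgM cv1 (cvg_cst c); rewrite mul1r; exact.
apply: (@cvg_prod_cst1 _ (fun j N => alt_ratio (m * (j + N)))) => j.
apply: (cvg_comp _ _ _ cvg_alt_ratio).
(* As [m > 0], [N >= M] gives [m * (j + N) >= M]. *)
move=> A [M _ MA]; exists M => // N /= MN; apply: MA => /=.
by nia.
Qed.

(** * Closed forms of the limits *)

Lemma alt_ratio_even j : ~~ odd j ->
  (alt_ratio j)^-1 = s5^-1 * ((lucas j)%:R / (fib j)%:R).
Proof.
move=> /negPf oj; rewrite /alt_ratio oj /fib_lucas_ratio.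
by rewrite !invfM invrK mulrAC mulrA.
Qed.

Lemma alt_ratio_odd j : odd j ->
  (alt_ratio j)^-1 = s5 * ((fib j)%:R / (lucas j)%:R).
Proof. by move=> oj; rewrite /alt_ratio oj invrK mulrA. Qed.

Lemma prod_alt_ratio_even (m p : nat) : ~~ odd m ->
  \prod_(1 <= j < p.+1) (alt_ratio (m * j))^-1
  = 1 / s5 ^+ p * \prod_(1 <= j < p.+1) ((lucas (m * j))%:R / (fib (m * j))%:R).
Proof.
move=> even_m.
under eq_bigr do rewrite alt_ratio_even ?oddM ?(negPf even_m) //.
by rewrite big_split /= prodr_const_nat subn1 exprVn mul1r.
Qed.

(** For odd [m] the parity of [m * j] is that of [j], so the factors at [2k - 1] and [2k] pair up
    and their powers of [sqrt 5] cancel. *)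
Lemma prod_alt_ratio_odd_even (m q : nat) : odd m ->
  \prod_(1 <= j < (2 * q).+1) (alt_ratio (m * j))^-1
  = \prod_(1 <= k < q.+1)
      (((fib (m * (2 * k - 1)))%:R * (lucas (m * (2 * k)))%:R)
       / ((lucas (m * (2 * k - 1)))%:R * (fib (m * (2 * k)))%:R)).
Proof.
move=> odd_m; elim: q => [|q IH]; first by rewrite muln0 !big_nil.
rewrite (big_nat_recr q.+1) //= -IH (_ : 2 * q.+1 = (2 * q).+2)%N; last by lia.
rewrite (_ : (2 * q).+2 - 1 = (2 * q).+1)%N; last by lia.
rewrite (big_nat_recr (2 * q).+2) //= (big_nat_recr (2 * q).+1) //=.
rewrite (@alt_ratio_odd (m * (2 * q).+1)); last by rewrite oddM odd_m /= oddM.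
rewrite (@alt_ratio_even (m * (2 * q).+2)); last by rewrite oddM odd_m /= oddM.
rewrite -!mulrA; congr (_ * _); field.
by rewrite sqrt5_neq0 !lucasR_neq0 !fibR_neq0 // muln_gt0 odd_gt0.
Qed.

(** With an odd number of factors there is one more odd index than even ones, which leaves a single
    [sqrt 5]. *)
Lemma prod_alt_ratio_odd_odd (m q : nat) : odd m ->
  \prod_(1 <= j < (2 * q).+2) (alt_ratio (m * j))^-1
  = s5 * (\prod_(1 <= k < q.+2)
            ((fib ((2 * k - 1) * m))%:R / (lucas ((2 * k - 1) * m))%:R))
       * (\prod_(1 <= k < q.+1)
            ((lucas (2 * k * m))%:R / (fib (2 * k * m))%:R)).
Proof.
move=> odd_m; elim: q => [|q IH].
  by rewrite !big_nat1 big_nil mulr1 !muln1 mul1n alt_ratio_odd.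
rewrite (_ : 2 * q.+1 = (2 * q).+2)%N; last by lia.
rewrite (big_nat_recr (2 * q).+3) //= (big_nat_recr (2 * q).+2) //=.
rewrite (big_nat_recr q.+2) //=.
move: IH; set A := \prod_(1 <= k < q.+2) _ => ->.
rewrite (big_nat_recr q.+1) //=.
rewrite (_ : 2 * q.+2 - 1 = (2 * q).+3)%N; last by lia.
rewrite (_ : 2 * q.+1 = (2 * q).+2)%N; last by lia.
rewrite !(mulnC _ m).
rewrite (@alt_ratio_even (m * (2 * q).+2)); last by rewrite oddM odd_m /= oddM.
rewrite (@alt_ratio_odd (m * (2 * q).+3)); last by rewrite oddM odd_m /= oddM.
field.
by rewrite sqrt5_neq0 !lucasR_neq0 !fibR_neq0 // muln_gt0 odd_gt0.
Qed.

End binet.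

(** * The four identities, by the choice of [m] and [p] *)

Theorem theorem1 (R : realType) (q n : nat) (hq : (0 < q)%N) (hn : (0 < n)%N) :
  [/\ infinite_prod_eq
        (fun k : nat =>
           ((lucas ((2 * n - 1) * (2 * k + 2 * q - 1)))%:R
              + (lucas ((2 * n - 1) * (2 * q - 1)))%:R)
           / ((lucas ((2 * n - 1) * (2 * k + 2 * q - 1)))%:R
                - (lucas ((2 * n - 1) * (2 * q - 1)))%:R))
        (Num.sqrt (5%:R : R)
         * (\prod_(1 <= k < q.+1)
              ((fib ((2 * k - 1) * (2 * n - 1)))%:R
               / (lucas ((2 * k - 1) * (2 * n - 1)))%:R))
         * (\prod_(1 <= k < q)
              ((lucas (2 * k * (2 * n - 1)))%:R
               / (fib (2 * k * (2 * n - 1)))%:R))),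
      infinite_prod_eq
        (fun k : nat =>
           ((fib (2 * n * (2 * k + 2 * q - 1)))%:R
              + (fib (2 * n * (2 * q - 1)))%:R)
           / ((fib (2 * n * (2 * k + 2 * q - 1)))%:R
                - (fib (2 * n * (2 * q - 1)))%:R))
        (1 / (Num.sqrt (5%:R : R)) ^+ (2 * q - 1)
         * \prod_(1 <= k < (2 * q - 1).+1)
             ((lucas (2 * n * k))%:R / (fib (2 * n * k))%:R)),
      infinite_prod_eq
        (fun k : nat =>
           ((fib (4 * n * (k + q)))%:R + (fib (4 * n * q))%:R)
           / ((fib (4 * n * (k + q)))%:R - (fib (4 * n * q))%:R))
        (1 / (5%:R : R) ^+ q
         * \prod_(1 <= k < (2 * q).+1)
             ((lucas (2 * n * k))%:R / (fib (2 * n * k))%:R))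
    & infinite_prod_eq
        (fun k : nat =>
           ((fib ((2 * n - 1) * (2 * k + 2 * q)))%:R
              + (fib (2 * q * (2 * n - 1)))%:R)
           / ((fib ((2 * n - 1) * (2 * k + 2 * q)))%:R
                - (fib (2 * q * (2 * n - 1)))%:R))
        (\prod_(1 <= k < q.+1)
           (((fib ((2 * n - 1) * (2 * k - 1)))%:R
               * (lucas ((2 * n - 1) * (2 * k)))%:R)
            / ((lucas ((2 * n - 1) * (2 * k - 1)))%:R
                 * (fib ((2 * n - 1) * (2 * k)))%:R) : R))].
Proof.
have odd_m : odd (2 * n - 1) by lia.
have m_gt0 := odd_gt0 odd_m.
split.
(* Here [m = 2n - 1] and [p = 2q - 1], which is [2q' + 1] for [q = q' + 1]; [w = m * p] is odd. *)
- case: q hq => // q' _.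
  rewrite -prod_alt_ratio_odd_odd //.
  apply: infinite_prod_alt_ratio => // k k_gt0.
  rewrite -lucas_factor ?muln_gt0 ?m_gt0 ?oddM ?odd_m //=; last by lia.
  by do ![congr (_ + _) || congr (_ / _) || congr (- _)];
    congr (lucas _)%:R; lia.
(* Here [m = 2n] and [p = 2q - 1]. *)
- rewrite -prod_alt_ratio_even ?oddM //.
  apply: infinite_prod_alt_ratio => [|k k_gt0]; first by lia.
  rewrite -fib_factor ?oddM //; last by lia.
  by do ![congr (_ + _) || congr (_ / _) || congr (- _)];
    congr (fib _)%:R; lia.
(* Here [m = 2n] and [p = 2q], with [5 ^ q] read as [(sqrt 5) ^ (2q)]; the index [4n(k + q)] is
   [2v + w] for [v = 2nk], [w = 4nq]. *)
- rewrite -sqr_sqrt5 -expr2 -exprM -prod_alt_ratio_even ?oddM //.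
  apply: infinite_prod_alt_ratio => [|k k_gt0]; first by lia.
  rewrite -fib_factor ?oddM //; last by lia.
  by do ![congr (_ + _) || congr (_ / _) || congr (- _)];
    congr (fib _)%:R; lia.
(* Here [m = 2n - 1] and [p = 2q], so [w = m * p] is even. *)
- rewrite -prod_alt_ratio_odd_even //.
  apply: infinite_prod_alt_ratio => // k k_gt0.
  rewrite -fib_factor ?muln_gt0 ?m_gt0 ?oddM ?andbF //=.
  by do ![congr (_ + _) || congr (_ / _) || congr (- _)];
    congr (fib _)%:R; lia.
Qed.
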